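(* Let $\mathbb{F}$ be a field, $n\ge1$, $k\ge0$, and $\mathcal{G} \subset \binom{[n]}{2}$. Then \[ \max \left\{\dim U: ~U \leq A_{\mathcal{G}}(\mathbb{F})~,~ \rho(U) \leq 2k\right\}= \max \left\{|\mathcal{G}'|:~ \mathcal{G}' \subset \mathcal{G}~,~ \nu(\mathcal{G}') \leq k\right\}. \]
   Context: $[n]=\{1,\dots,n\}$ and $\binom{[n]}{2}$ is the set of 2-element subsets of $[n]$ (so $\mathcal{G}$ is a graph on $[n]$). A matrix $A\in M_n(\mathbb{F})$ is alternating if $A=-A^t$ and $A(i,i)=0$ for all $i$; $A_n(\mathbb{F})$ denotes the space of alternating matrices. $A_{\mathcal{G}}(\mathbb{F})=\{A\in A_n(\mathbb{F}):A(i,j)=0 \text{ whenever } \{i,j\}\notin\mathcal{G}\}$. A matching in $\mathcal{G}$ is a set of pairwise disjoint edges of $\mathcal{G}$, and $\nu(\mathcal{G})$ is the maximum size of a matching. For $S\subset M_n(\mathbb{F})$, $\rho(S)=\max\{\mathrm{rk}(A):A\in S\}$. $U\le V$ means $U$ is a linear subspace of $V$. *)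

(* Defs.v *)
From HB Require Import structures.
From mathcomp Require Import all_boot all_order all_algebra.
From mathcomp Require Import boolp.

Set Implicit Arguments.
Unset Strict Implicit.
Unset Printing Implicit Defensive.

Import GRing.Theory.
Local Open Scope ring_scope.

(* A graph on [n] is its edge set, a subset of pairs n; [n] is rendered as
   'I_n = {0, ..., n-1}. *)
Definition pairs (n : nat) : {set {set 'I_n}} :=
  [set e : {set 'I_n} | #|e| == 2%N].

Definition matching (n : nat) (G M : {set {set 'I_n}}) : bool :=
  (M \subset G) && trivIset M.

Definition matching_number (n : nat) (G : {set {set 'I_n}}) : nat :=
  (\max_(M : {set {set 'I_n}} | matching G M) #|M|)%N.

Definition alternating (F : fieldType) (n : nat) : {pred 'M[F]_n} :=
  fun A => (A == - A^T) && [forall i, A i i == 0].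

Definition alternating_on (F : fieldType) (n : nat) (G : {set {set 'I_n}}) :
    {pred 'M[F]_n} :=
  fun A => (A \in @alternating F n) &&
    [forall i, forall j, ([set i; j] \notin G) ==> (A i j == 0)].

Arguments alternating_on F {n} G _.

(* The ranks of n x n matrices lie in {0, ..., n}, so the maximum may be taken
   over those r in that range which are the rank of some element of S. *)
Definition max_rank (F : fieldType) (n : nat) (S : {pred 'M[F]_n}) : nat :=
  (\max_(r < n.+1 | `[< exists2 A, A \in S & \rank A = r :> nat >]) r)%N.

Definition is_max (P : nat -> Prop) (m : nat) : Prop :=
  P m /\ forall d, P d -> (d <= m)%N.

(* Main.v *)
Require Import Defs.
From HB Require Import structures.
From mathcomp Require Import all_boot all_order all_algebra.
From mathcomp Require Import boolp zify ring.

(* An alternating matrix has rank at least [2m] iff one of its principal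
   Pfaffians on [2m] indices is nonzero, and such a Pfaffian exhibits a matching
   of size [m] in the support; hence the space of all alternating matrices
   supported on G' has rank at most 2 nu(G').

   Conversely, order the edges by the weight 2^i + 2^j and let G' be the set of
   heaviest edges in the supports of the nonzero elements of U.  The entries at
   G' determine an element of U, so dim U <= |G'|.  Let e_1, ..., e_m be a
   matching in G' and B_l in U have leading edge e_l.  On the vertices of the
   matching, the coefficient of x_1 ... x_m in Pf (x_1 B_1 + ... + x_m B_m) is a
   sum over perfect matchings (f_l) of the products of the entries of B_l at
   f_l.  A nonzero term has w(f_l) <= w(e_l) for every l, and both families have
   the same total weight, so f_l = e_l: the coefficient is a single nonzero
   product.  As Pf has degree m, the coefficient is an alternating sum of values
   of Pf at 0/1 points, so over any field some 0/1 combination of the B_l has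
   rank at least 2m. *)

Set Implicit Arguments.
Unset Strict Implicit.
Unset Printing Implicit Defensive.

Import GRing.Theory.
Local Open Scope ring_scope.

(** * Pfaffians as iterated contractions along a list *)

Section Contraction.
Variables (R : fieldType) (T : eqType).
Implicit Types (b : T -> T -> R) (f g : seq T -> R) (s : seq T) (u v x y : T).

(* [\sum_k (-1)^k b(u, s_k) f(s \ s_k)]; recursing through [f] rather than on
   the index [k] makes the two-fold contraction identities immediate. *)
Fixpoint contract b u f s : R :=
  if s is v :: s' then b u v * f s' - contract b u (fun t => f (v :: t)) s'
  else 0.

Lemma eq_contract b u f g s : f =1 g -> contract b u f s = contract b u g s.
Proof.
by move=> fg; elim: s f g fg => //= v s IH f g fg; rewrite fg (IH _ (g \o cons v)).
Qed.

Lemma eq_contractl b b' u f s :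
  b =2 b' -> contract b u f s = contract b' u f s.
Proof. by move=> bb; elim: s f => //= v s IH f; rewrite bb IH. Qed.

Lemma contract0 b u s : contract b u (fun=> 0) s = 0.
Proof. by elim: s => //= v s ->; rewrite mulr0 subr0. Qed.

Lemma contractB b u f g s :
  contract b u (fun t => f t - g t) s = contract b u f s - contract b u g s.
Proof.
elim: s f g => [|v s IH] f g /=; first by rewrite subr0.
by rewrite IH; ring.
Qed.

Lemma contractN b u f s :
  contract b u (fun t => - f t) s = - contract b u f s.
Proof.
elim: s f => [|v s IH] f /=; first by rewrite oppr0.
by rewrite IH; ring.
Qed.

Lemma contractZ b u c f s :
  contract b u (fun t => c * f t) s = c * contract b u f s.
Proof.
elim: s f => [|v s IH] f /=; first by rewrite mulr0.
by rewrite IH; ring.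
Qed.

Lemma contractD b b' u f s :
  contract (fun x y => b x y + b' x y) u f s
  = contract b u f s + contract b' u f s.
Proof.
elim: s f => [|v s IH] f /=; first by rewrite addr0.
by rewrite IH; ring.
Qed.

(** Deleting the earlier of two entries moves the later one up by one position, so exchanging the
    order of the deletions flips the sign. *)
Lemma contractC b x y f s :
  contract b x (contract b y f) s = - contract b y (contract b x f) s.
Proof.
elim: s f => [|v s IH] f /=; first by rewrite oppr0.
rewrite !contractB !contractZ IH; ring.
Qed.

(** Taking [y = x] in [contractC] only says that the value is its own negative, which decides
    nothing in characteristic 2; hence a separate induction. *)
Lemma contractxx b x f s : contract b x (contract b x f) s = 0.
Proof.
elim: s f => [|v s IH] f //=.
by rewrite contractB contractZ IH subr0 subrr.
Qed.

Lemma contractE b u f s : uniq s ->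
  contract b u f s
  = \sum_(v <- s) (-1) ^+ index v s * b u v * f (rem v s).
Proof.
elim: s f => [|v s IH] f /=; first by rewrite big_nil.
case/andP=> vs us; rewrite big_cons !eqxx expr0 mul1r IH // -sumrN.
congr (_ + _); apply: eq_big_seq => w ws.
have /negbTE vw : v != w by apply: contraNneq vs => ->.
by rewrite vw exprS !mulN1r !mulNr.
Qed.

Definition alternating_form b :=
  (forall x, b x x = 0) /\ (forall x y, b x y = - b y x).

(* Pfaffian of [b] on the list [s], expanded along its head; it is [0] unless
   [size s = m.*2]. *)
Fixpoint pfaffian b m s : R :=
  match m, s with
  | 0%N, [::] => 1
  | m'.+1, u :: s' => contract b u (pfaffian b m') s'
  | _, _ => 0
  end.

Section Swap.
Variables x y : T.

Let swaps f := forall p q, f (p ++ x :: y :: q) = - f (p ++ y :: x :: q).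
Let kills f := forall p q, f (p ++ x :: x :: q) = 0.

Lemma contract_swap b u f : swaps f -> swaps (contract b u f).
Proof.
move=> sf p; elim: p f sf => [|v p IH] f sf q /=; last first.
  rewrite sf (IH (f \o cons v)) /comp /=; first by ring.
  by move=> p' q'; apply: (sf (v :: p')).
rewrite (@eq_contract _ _ _ (fun t => - f [:: y, x & t])); last first.
  by move=> t; apply: (sf [::]).
rewrite contractN; ring.
Qed.

Lemma contract_kill b u f : kills f -> kills (contract b u f).
Proof.
move=> sf p; elim: p f sf => [|v p IH] f sf q /=; last first.
  rewrite sf (IH (f \o cons v)) /comp /=; first by ring.
  by move=> p' q'; apply: (sf (v :: p')).
rewrite (@eq_contract _ _ _ (fun t => 0)) ?contract0; first by ring.
by move=> t; apply: (sf [::]).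
Qed.

(** A swap behind the head passes through the contraction. At the head, two expansions leave a
    multiple of [b x y] and a double contraction, both of which change sign. *)
Lemma pfaffian_swap b m : alternating_form b -> swaps (pfaffian b m).
Proof.
case=> b0 bN; elim: m => [|m IH] [|u p] q /=; rewrite ?oppr0 //; last first.
  exact: contract_swap.
case: m IH => [|m] IH /=; rewrite ?contract0 (bN x y).
  by ring.
rewrite contractC; ring.
Qed.

Lemma pfaffian_kill b m : alternating_form b -> kills (pfaffian b m).
Proof.
case=> b0 bN; elim: m => [|m IH] [|u p] q //=; last first.
  exact: contract_kill.
rewrite b0 mul0r sub0r; case: m {IH} => [|m] /=; rewrite ?contract0 ?oppr0 //.
by rewrite contractxx oppr0.
Qed.

End Swap.

(** Neighbour swaps bring the two copies of [x] together, changing only the sign. *)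
Lemma pfaffian_repeat b m p x q r : alternating_form b ->
  pfaffian b m (p ++ x :: q ++ x :: r) = 0.
Proof.
move=> altb; elim: q p => [|y q IH] p /=; first exact: pfaffian_kill.
by rewrite pfaffian_swap // -cat_rcons IH oppr0.
Qed.

Lemma pfaffian_uniq b m s : alternating_form b -> pfaffian b m s != 0 -> uniq s.
Proof.
move=> altb; apply: contraNT => us; apply/eqP.
suff [p [x [q [r ->]]]] : exists p x q r, s = p ++ x :: q ++ x :: r.
  exact: pfaffian_repeat.
elim: s us => //= x s IH; rewrite negb_and negbK => /orP[|/IH].
  by case/splitPr=> q r; exists [::], x, q, r.
by case=> p [y [q [r ->]]]; exists (x :: p), y, q, r.
Qed.

Lemma pfaffian_to_front b m p x q : alternating_form b ->
  pfaffian b m (x :: p ++ q) = (-1) ^+ size p * pfaffian b m (p ++ x :: q).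
Proof.
move=> altb; elim/last_ind: p q => [|p y IH] q /=; first by rewrite mul1r.
rewrite cat_rcons IH pfaffian_swap // size_rcons cat_rcons exprS; ring.
Qed.

Lemma pfaffian_front_neq0 b m s x : alternating_form b ->
  x \in s -> pfaffian b m s != 0 -> pfaffian b m (x :: rem x s) != 0.
Proof.
move=> altb xs pf0; have us := pfaffian_uniq altb pf0.
case/splitPr: xs us pf0 => p q us pf0.
have xp : x \notin p by move: us; rewrite cat_uniq /= negb_or => /and3P[_ /andP[]].
have -> : rem x (p ++ x :: q) = p ++ q.
  elim: p xp {us pf0} => [_|y p IH] /=; first by rewrite eqxx.
  by rewrite inE negb_or eq_sym => /andP[/negbTE-> /IH->].
rewrite pfaffian_to_front //.
by rewrite mulf_neq0 // signr_eq0.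
Qed.

Lemma pfaffian_size b m s : pfaffian b m s != 0 -> size s = m.*2.
Proof.
(* A contraction deletes exactly one entry, so it raises by one the only length at which the
   function can be nonzero. *)
suff h : forall f u k t, (forall t', size t' != k -> f t' = 0) ->
    size t != k.+1 -> contract b u f t = 0.
  move=> pf0; apply/eqP; apply: contraNT pf0 => ns; apply/eqP.
  elim: m s ns => [|m IH] [|u s] //= ns.
  exact: (h _ _ m.*2).
move=> f u k t; elim: t f k => //= v t IH f k fk nt.
rewrite fk ?mulr0 ?sub0r; last by apply: contraNneq nt => ->.
case: k fk nt => [|k] fk nt.
  rewrite (@eq_contract _ _ _ (fun=> 0)) ?contract0 ?oppr0 // => t'.
  exact: fk.
by rewrite (IH _ k) ?oppr0 // => t' kt'; apply: fk.
Qed.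

Lemma pfaffian_expand_neq0 b m u s : uniq s -> pfaffian b m.+1 (u :: s) != 0 ->
  exists v, [/\ v \in s, b u v != 0 & pfaffian b m (rem v s) != 0].
Proof.
move=> us /=; rewrite contractE // => nz; apply: contrapT => nex.
case/eqP: nz; rewrite big1_seq // => v /andP[_ vs].
apply/eqP; apply: contra_notT nex => h; exists v; split=> //.
  by apply: contraNneq h => ->; rewrite mulr0 mul0r.
by apply: contraNneq h => ->; rewrite mulr0.
Qed.

End Contraction.

(** * Finite differences of the Pfaffian *)

Section PfaffianDifference.
Variables (F : fieldType) (n : nat) (E : eqType) (B : E -> 'M[F]_n).
Implicit Types (D : 'M[F]_n) (L : seq E) (s : seq 'I_n).

(* Iterated finite difference, in the directions [B e] for [e] in [L]: when
   [size L = m] it extracts the mixed coefficient of the form of degree [m]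
   that [pfaffian] is. *)
Fixpoint pfdiff L D m s : F :=
  if L is e :: L' then pfdiff L' (D + B e) m s - pfdiff L' D m s
  else pfaffian D m s.

Lemma pfdiff_nil L D m : pfdiff L D m.+1 [::] = 0.
Proof. by elim: L D => //= e L IH D; rewrite !IH subrr. Qed.

(** A discrete Leibniz rule: the row of [u] is linear in the matrix, so at most one direction [e] is
    spent on it, and the other factor is then evaluated at the shifted point [D + B e]. *)
Lemma pfdiff_cons L D m u s : uniq L ->
  pfdiff L D m.+1 (u :: s) =
  contract D u (pfdiff L D m) s
  + \sum_(e <- L) contract (B e) u (pfdiff (rem e L) (D + B e) m) s.
Proof.
elim: L D => [|e L IH] D /=; first by rewrite big_nil addr0.
case/andP=> eL uL; rewrite !IH // big_cons eqxx contractB.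
rewrite (@eq_contractl _ _ (D + B e) (fun x y => D x y + B e x y));
  last by move=> x y; rewrite mxE.
rewrite contractD.
rewrite [X in _ = _ + (_ + X)](_ : _ =
   \sum_(a <- L) contract (B a) u (pfdiff (rem a L) (D + B e + B a) m) s
   - \sum_(a <- L) contract (B a) u (pfdiff (rem a L) (D + B a) m) s).
  by ring.
rewrite -sumrB; apply: eq_big_seq => a aL.
have /negbTE -> : e != a by apply: contraNneq eL => ->.
rewrite -contractB; apply: eq_contract => t /=.
by rewrite addrAC.
Qed.

(** More than [m] differences kill a form of degree [m]. *)
Lemma pfdiff_low L D m s : uniq L -> (m < size L)%N -> pfdiff L D m s = 0.
Proof.
elim: m L D s => [|m IH] L D s uL ltmL.
  case: L uL ltmL => //= e L _ _.
  suff h : forall D', pfdiff L D' 0 s = pfdiff L 0 0 s by rewrite !h subrr.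
  elim: L => [|a L IHL] D' /=; first by case: s.
  by rewrite !(IHL (_ + _)) (IHL D') !subrr.
case: s => [|u s]; first exact: pfdiff_nil.
rewrite pfdiff_cons // (@eq_contract _ _ _ _ _ (fun=> 0)); last first.
  by move=> t; apply: IH => //; apply: ltnW.
rewrite contract0 add0r big1_seq // => e /andP[_ eL].
rewrite (@eq_contract _ _ _ _ _ (fun=> 0)) ?contract0 // => t.
by apply: IH; rewrite ?rem_uniq // size_rem //; case: (L) eL ltmL.
Qed.

(** The first term of [pfdiff_cons] takes [m.+1] differences of a form of degree [m], so it drops
    out. *)
Lemma pfdiff_expand L D m u s : uniq L -> uniq s -> size L = m.+1 ->
  pfdiff L D m.+1 (u :: s) =
  \sum_(e <- L) \sum_(v <- s)
    (-1) ^+ index v s * B e u v * pfdiff (rem e L) (D + B e) m (rem v s).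
Proof.
move=> uL us sL; rewrite pfdiff_cons // (@eq_contract _ _ _ _ _ (fun=> 0)).
  by rewrite contract0 add0r; apply: eq_bigr => e _; rewrite contractE.
by move=> t; apply: pfdiff_low; rewrite ?sL.
Qed.

(** The difference is a signed sum of Pfaffians at [D] plus subset sums of the [B e]; one of them
    must be nonzero. *)
Lemma pfdiff_neq0 (U : {vspace 'M[F]_n}) L D m s :
  {in L, forall e, B e \in U} -> pfdiff L D m s != 0 ->
  exists2 C, C \in U & pfaffian (D + C) m s != 0.
Proof.
elim: L D => [|e L IH] D BU /=.
  by exists 0; rewrite ?mem0v ?addr0.
have BL : {in L, forall e, B e \in U}.
  by move=> a aL; apply: BU; rewrite inE aL orbT.
have [d0|d0 _] := eqVneq (pfdiff L D m s) 0; last exact: IH.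
rewrite d0 subr0 => /IH -/(_ BL)[C CU pC]; exists (B e + C); last by rewrite addrA.
by rewrite memvD // BU // inE eqxx.
Qed.

End PfaffianDifference.

(** * Edge weights from powers of two *)

Lemma expn2_pair_inj (a b c d : nat) : (a != b)%N -> (c != d)%N ->
  (2 ^ a + 2 ^ b = 2 ^ c + 2 ^ d)%N -> (a == c) && (b == d) || (a == d) && (b == c).
Proof.
suff h : forall a b c d : nat, (a < b)%N -> (c < d)%N ->
    (2 ^ a + 2 ^ b = 2 ^ c + 2 ^ d)%N -> (a = c) /\ (b = d).
  rewrite !neq_ltn => /orP[ab|ab] /orP[cd|cd] E.
  - by have [-> ->] := h _ _ _ _ ab cd E; rewrite !eqxx.
  - by rewrite [RHS]addnC in E; have [-> ->] := h _ _ _ _ ab cd E; rewrite !eqxx orbT.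
  - by rewrite [LHS]addnC in E; have [-> ->] := h _ _ _ _ ab cd E; rewrite !eqxx orbT.
  - by rewrite addnC [RHS]addnC in E; have [-> ->] := h _ _ _ _ ab cd E; rewrite !eqxx.
have half i j : (i < j -> (2 ^ i).*2 <= 2 ^ j)%N.
  by move=> ij; rewrite -mul2n -expnS leq_exp2l.
move=> {a b c d} a b c d ab cd E.
have pa : (0 < 2 ^ a)%N by rewrite expn_gt0.
have pc : (0 < 2 ^ c)%N by rewrite expn_gt0.
(* If [b < d] then 2^a + 2^b < 2^(b+1) <= 2^d, and symmetrically. *)
have bd : b = d.
  have [bd|db|//] := ltngtP b d.
    by have := half _ _ bd; have := half _ _ ab; lia.
  by have := half _ _ db; have := half _ _ cd; lia.
split=> //; subst d; move/addIn: E => /eqP; rewrite eqn_exp2l // => /eqP ->.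
by [].
Qed.

(* Any weights with distinct pairwise sums would do; their additivity over
   disjoint edges is what singles out one matching in [pfdiff]. *)
Definition weight n (s : seq 'I_n) : nat := (\sum_(i <- s) 2 ^ i)%N.

Definition edge_weight n (e : {set 'I_n}) : nat := (\sum_(i in e) 2 ^ i)%N.

Lemma weight_cons_rem n (u v : 'I_n) s : v \in s ->
  weight (u :: s) = (2 ^ u + 2 ^ v + weight (rem v s))%N.
Proof. by move=> vs; rewrite /weight big_cons (big_rem v) //= addnA. Qed.

Lemma weight_pair_inj n (u v : 'I_n) (e : {set 'I_n}) : u != v -> #|e| = 2 ->
  (2 ^ u + 2 ^ v = edge_weight e)%N -> e = [set u; v].
Proof.
move=> uv /eqP/cards2P[c [d [cd ->]]].
rewrite /edge_weight big_setU1 ?inE //= big_set1.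
move=> /(expn2_pair_inj uv cd)/orP[]/andP[/eqP/val_inj-> /eqP/val_inj->] //.
by rewrite setUC.
Qed.

(** * Leading edges and the surviving perfect matching *)

Section Leading.
Variables (F : fieldType) (n : nat) (B : {set 'I_n} -> 'M[F]_n).
Implicit Types (D : 'M[F]_n) (L : seq {set 'I_n}) (s : seq 'I_n).

Definition leading (e : {set 'I_n}) (A : 'M[F]_n) :=
  (forall i j, A i j != 0 -> (2 ^ i + 2 ^ j <= edge_weight e)%N) /\
  (forall i j, e = [set i; j] -> A i j != 0).

Let tweight L : nat := (\sum_(e <- L) edge_weight e)%N.

(** A nonzero term would split [s] into pairs, each no heavier than the edge of [L] whose matrix
    supplies the entry; their total cannot exceed that of [L]. *)
Lemma pfdiff_heavy L D m s : {in L, forall e, leading e (B e)} ->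
  uniq L -> uniq s -> size L = m -> (tweight L < weight s)%N ->
  pfdiff B L D m s = 0.
Proof.
elim: m L D s => [|m IH] L D s ldL uL us sL lt.
  by case: L sL lt {ldL uL} => //= _; case: s us => //; rewrite /weight big_nil.
case: s us lt => [_|u s]; first by rewrite /weight big_nil ltn0.
case/andP=> us uns lt; rewrite pfdiff_expand //.
rewrite big1_seq // => e /andP[_ eL]; rewrite big1_seq // => v /andP[_ vs].
have [->|nz] := eqVneq (B e u v) 0; first by rewrite mulr0 mul0r.
rewrite IH ?mulr0 ?rem_uniq //.
- by move=> a /mem_rem; apply: ldL.
- by rewrite size_rem // sL.
move: lt; rewrite /tweight (big_rem e) //= (weight_cons_rem u vs).
by have := (ldL e eL).1 _ _ nz; lia.
Qed.

(** Induction along the head of [s], with [D] arbitrary because each expansion shifts it by some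
    [B e]. *)
Lemma pfdiff_matching_neq0 L D m s :
  {in L, forall e, leading e (B e)} -> {in L, forall e : {set 'I_n}, #|e| = 2} ->
  {in L &, forall (e e' : {set 'I_n}) x, x \in e -> x \in e' -> e = e'} ->
  uniq L -> uniq s -> size L = m -> (forall x, (x \in s) = has (fun e : {set 'I_n} => x \in e) L) ->
  tweight L = weight s -> pfdiff B L D m s != 0.
Proof.
elim: m L D s => [|m IH] L D s ldL L2 disL uL us sL covL eqw.
  move/size0nil: sL => L0; subst L; case: s covL {us eqw} => [_|u s /(_ u)] /=.
    exact: oner_neq0.
  by rewrite inE eqxx.
case: s us covL eqw => [|u s] /=.
  case: L sL L2 {ldL disL uL} => // e L _ L2 _ /=.
  have /eqP/cards2P[x [y [_ ->]]] : #|e| = 2 by apply: L2; rewrite inE eqxx.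
  by move=> /(_ x); rewrite /= !inE eqxx.
case/andP=> us uns covL eqw.
have /hasP[e eL ue] : has (fun e : {set 'I_n} => u \in e) L by rewrite -covL inE eqxx.
have [v uv eE] : exists2 v, u != v & e = [set u; v].
  have /eqP/cards2P[x [y [xy eE]]] := L2 e eL.
  move: ue; rewrite eE !inE => /orP[]/eqP->; first by exists y.
  by exists x; rewrite 1?eq_sym // setUC.
have vs : v \in s.
  have : v \in u :: s by rewrite covL; apply/hasP; exists e; rewrite // eE !inE eqxx orbT.
  by rewrite inE eq_sym (negbTE uv).
have we : edge_weight e = (2 ^ u + 2 ^ v)%N.
  by rewrite /edge_weight eE big_setU1 ?inE //= big_set1.
have ldr a : {in rem a L, forall e, leading e (B e)}.
  by move=> ? /mem_rem; apply: ldL.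
have szr a : a \in L -> size (rem a L) = m by move=> aL; rewrite size_rem // sL.
have remw a w : a \in L -> w \in s ->
    (edge_weight a + tweight (rem a L) = 2 ^ u + 2 ^ w + weight (rem w s))%N.
  move=> aL ws; move: eqw.
  by rewrite /tweight (big_rem a) //= (weight_cons_rem u ws).
(* A pair [u], [w] lighter than [a] leaves a remainder too heavy for [rem a L]; equal weight forces
   [a = [set u; w]], hence [a = e] and [w = v]. *)
have others a w : a \in L -> w \in s -> (a != e) || (w != v) ->
    B a u w * pfdiff B (rem a L) (D + B a) m (rem w s) = 0.
  move=> aL ws aw; have [->|nz] := eqVneq (B a u w) 0; first by rewrite mul0r.
  have le := (ldL a aL).1 _ _ nz.
  have [ltw|] := boolP (2 ^ u + 2 ^ w < edge_weight a)%N.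
    rewrite pfdiff_heavy ?mulr0 ?rem_uniq ?szr //.
    by have := remw a w aL ws; lia.
  rewrite -leqNgt => ge; have /esym eqa := anti_leq (introT andP (conj ge le)).
  have uw : u != w by apply: contraNneq us => ->.
  have aE := weight_pair_inj uw (L2 a aL) eqa.
  have ae : a = e by apply: (disL a e aL eL u) => //; rewrite aE !inE eqxx.
  move: aw; rewrite ae eqxx /= => /negP[].
  have : w \in e by rewrite -ae aE !inE eqxx orbT.
  by rewrite eE !inE eq_sym (negbTE uw).
rewrite pfdiff_expand // (bigD1_seq e) //= [X in _ + X]big1_seq ?addr0; last first.
  move=> a /andP[ae aL]; rewrite big1_seq // => w /andP[_ ws].
  by rewrite -mulrA others ?mulr0 // ae.
rewrite (bigD1_seq v) //= [X in _ + X]big1_seq ?addr0; last first.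
  by move=> w /andP[wv ws]; rewrite -mulrA others ?mulr0 // wv orbT.
rewrite !mulf_neq0 ?signr_eq0 //; first exact: (ldL e eL).2.
apply: IH; rewrite ?rem_uniq ?szr //.
- by move=> a /mem_rem /L2.
- by move=> a b /mem_rem aL /mem_rem bL; apply: disL.
- move=> x; rewrite mem_rem_uniq // inE.
  apply/andP/hasP => [[xv xs]|[a]].
    have : x \in u :: s by rewrite inE xs orbT.
    rewrite covL => /hasP[a aL xa]; exists a => //.
    rewrite mem_rem_uniq // inE aL andbT; apply: contraTneq xa => ->.
    by rewrite eE !inE negb_or xv andbT; apply: contraNneq us => <-.
  rewrite mem_rem_uniq // inE => /andP[ae aL] xa.
  have nxe : x \notin e by apply: contra ae => xe; rewrite (disL a e aL eL x).
  move: nxe; rewrite eE !inE negb_or => /andP[xu ->]; split=> //.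
  have : x \in u :: s by rewrite covL; apply/hasP; exists a.
  by rewrite inE (negbTE xu).
- by have := remw e v eL vs; rewrite we; lia.
Qed.

Lemma leading_matching (U : {vspace 'M[F]_n}) (M : {set {set 'I_n}}) :
  trivIset M -> M \subset pairs n ->
  {in M, forall e, leading e (B e) /\ B e \in U} ->
  exists2 A, A \in U & exists s, pfaffian A #|M| s != 0.
Proof.
move=> tM Mp ldM.
have ldE : {in enum M, forall e, leading e (B e)}.
  by move=> e; rewrite mem_enum => /ldM[].
have BU : {in enum M, forall e, B e \in U} by move=> e; rewrite mem_enum => /ldM[].
(* With base point [0], the matrix given by [pfdiff_neq0] lies in [U] itself. *)
have : pfdiff B (enum M) 0 #|M| (enum (cover M)) != 0.
  apply: pfdiff_matching_neq0; rewrite ?enum_uniq -?cardE //.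
  - by move=> e; rewrite mem_enum => /(subsetP Mp); rewrite inE => /eqP.
  - move=> e e'; rewrite !mem_enum => eM eM' x xe xe'.
    by rewrite -(def_pblock tM eM xe) (def_pblock tM eM' xe').
  - move=> x; rewrite mem_enum; apply/bigcupP/hasP => -[e eM xe]; exists e => //.
      by rewrite mem_enum.
    by rewrite -mem_enum.
  by rewrite /tweight /weight !big_enum /= big_trivIset.
case/(pfdiff_neq0 BU) => C CU; rewrite add0r => pf0.
by exists C => //; exists (enum (cover M)).
Qed.

End Leading.

(** * Rank of an alternating matrix through its Pfaffians *)

Lemma alternatingP (F : fieldType) n (A : 'M[F]_n) :
  reflect (alternating_form A) (A \in @alternating F n).
Proof.
apply: (iffP andP) => [[/eqP AN /forallP A0]|[A0 AN]]; split.
- by move=> i; apply/eqP.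
- by move=> i j; rewrite {1}AN !mxE.
- by apply/eqP/matrixP => i j; rewrite !mxE.
- by apply/forallP => i; apply/eqP.
Qed.

Section Rank.
Variables (F : fieldType) (n : nat) (A : 'M[F]_n).
Hypothesis altA : alternating_form A.

(* The Pfaffians of [s] with two indices removed form, up to signs, the
   adjugate of the principal submatrix of [A] on [s]. *)
Lemma pfaffian_rank_ge m s : pfaffian A m s != 0 -> (m.*2 <= \rank A)%N.
Proof.
case: m => [//|m] pf0.
have us := pfaffian_uniq altA pf0; rewrite -(pfaffian_size pf0).
pose W := \matrix_(v, y) (if v \in rem y s then
  (-1) ^+ index v (rem y s) * pfaffian A m (rem v (rem y s)) else 0).
have AW x y : (A *m W) x y = pfaffian A m.+1 (x :: rem y s).
  rewrite /= contractE ?rem_uniq // (big_uniq _ (rem_uniq y us)) mxE [RHS]big_mkcond /=.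
  by apply: eq_bigr => v _; rewrite mxE; case: ifP => _; ring.
pose f := tnth (in_tuple s).
pose d := \row_i (A *m W) (f i) (f i).
have fs i : f i \in s by apply: mem_tnth.
have fE : mxsub f f (A *m W) = diag_mx d.
  apply/matrixP => i j; rewrite [LHS]mxE [RHS]mxE; have [->|ij] := eqVneq i j.
    by rewrite [in RHS]mxE.
  (* Off the diagonal, [f i] occurs twice in [f i :: rem (f j) s], so the Pfaffian vanishes. *)
  rewrite AW mulr0n; apply/eqP.
  apply: contraTT (isT) => /(pfaffian_uniq altA) /= /andP[].
  rewrite mem_rem_uniq // !inE fs andbT negbK => /eqP fij.
  by case/eqP: ij; apply: (elimT (tuple_uniqP (in_tuple s)) us).
have <- : \rank (mxsub f f (A *m W)) = size s.
  rewrite mxrank_unit // fE unitmxE det_diag unitfE; apply/prodf_neq0 => i _.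
  by rewrite mxE AW; apply: pfaffian_front_neq0.
rewrite mxsub_mul (leq_trans (mxrankM_maxl _ _)) // rowsubE.
exact: mxrankM_maxr.
Qed.

(* Expanding the vanishing Pfaffian of [x :: y :: s] along [x] writes column
   [y] of [A] as a combination of its columns indexed by [s]. *)
Lemma pfaffian_rank_le m s : pfaffian A m s != 0 ->
  (forall t, pfaffian A m.+1 t = 0) -> (\rank A <= m.*2)%N.
Proof.
move=> pf0 pfS; have us := pfaffian_uniq altA pf0.
rewrite -(pfaffian_size pf0); pose f := tnth (in_tuple s).
pose X := \matrix_(x, i) A x (f i).
pose Y := \matrix_(i, y) ((-1) ^+ index (f i) s
   * pfaffian A m (y :: rem (f i) s) / pfaffian A m s).
suff -> : A = X *m Y by apply: mulmx_max_rank.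
apply/matrixP => x y; rewrite mxE.
have := pfS [:: x, y & s]; rewrite /= => /eqP; rewrite subr_eq0 => /eqP E.
apply: (mulIf pf0); rewrite E contractE // [LHS]big_tnth mulr_suml.
apply: eq_bigr => i _; rewrite !mxE -/(f i); field.
by rewrite pf0.
Qed.

(** Each expansion along the head contributes an edge with nonzero entry. The bound on [cover M]
    keeps that edge disjoint from the matching found on the remaining indices. *)
Lemma pfaffian_matching (G : {set {set 'I_n}}) m s :
  (forall i j, A i j != 0 -> [set i; j] \in G) -> pfaffian A m s != 0 ->
  exists M, [/\ matching G M, #|M| = m & cover M \subset s].
Proof.
move=> AG pf0; have us := pfaffian_uniq altA pf0.
elim: m s us pf0 => [|m IH] s us pf0.
  exists set0; rewrite cards0 /matching sub0set; split=> //.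
    by apply/trivIsetP => ? ?; rewrite inE.
  by apply/subsetP => x; rewrite /cover big_set0 inE.
case: s us pf0 => [|u s]; first by rewrite eqxx.
case/andP=> nus us /(pfaffian_expand_neq0 us)[v [vs Auv]].
case/(IH _ (rem_uniq _ us)) => M [/andP[MG tM] cM covM].
have nu : u \notin cover M.
  by apply/negP => /(subsetP covM) /mem_rem; apply/negP.
have nv : v \notin cover M.
  by apply/negP => /(subsetP covM); rewrite mem_rem_uniq // !inE eqxx.
have uvM : [set u; v] \notin M.
  by apply: contra nu => eM; apply/bigcupP; exists [set u; v]; rewrite ?inE ?eqxx.
exists ([set u; v] |: M); split; last 1 first.
- apply/subsetP => x; rewrite /cover big_setU1 //= -/(cover M) !inE.
  case/orP=> [/orP[]/eqP->|/(subsetP covM)/mem_rem ->]; rewrite ?eqxx ?orbT //.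
  by rewrite vs orbT.
- apply/andP; split; first by rewrite subUset sub1set AG.
  have dM : {in M, forall e : {set 'I_n}, [disjoint [set u; v] & e]}.
    move=> e eM; rewrite disjoint_sym disjoints_subset; apply/subsetP => x xe.
    have xc : x \in cover M by apply/bigcupP; exists e.
    rewrite !inE negb_or; apply/andP; split; by apply: contraTneq xc => ->.
  apply/trivIsetP => e e'; rewrite !inE.
  case/orP=> [/eqP->|eM] /orP[/eqP->|eM'] ne; first by rewrite eqxx in ne.
  + exact: dM.
  + by rewrite disjoint_sym dM.
  + exact: (elimT trivIsetP tM).
- by rewrite cardsU1 uvM cM add1n.
Qed.

(** Take the largest [m] with a nonzero Pfaffian: [pfaffian_matching] bounds [m], and the vanishing
    at [m.+1] bounds the rank by [m.*2]. *)
Lemma rank_le_matching_number (G : {set {set 'I_n}}) :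
  (forall i j, A i j != 0 -> [set i; j] \in G) ->
  (\rank A <= 2 * matching_number G)%N.
Proof.
move=> AG; pose P m := `[< exists s, pfaffian A m s != 0 >].
have ubP m : P m -> (m <= matching_number G)%N.
  case/asboolP=> s /(pfaffian_matching AG)[M [mM <- _]].
  exact: (leq_bigmax_cond M).
have exP : exists m, P m by exists 0%N; apply/asboolP; exists [::]; apply: oner_neq0.
case: (ex_maxnP exP ubP) => m /[dup] Pm /asboolP[s pf0] maxm.
apply: (@leq_trans m.*2); last by rewrite mul2n leq_double ubP.
apply: pfaffian_rank_le pf0 _ => t; apply/eqP/negPn/negP => pft.
by have /maxm : P m.+1 by [apply/asboolP; exists t]; rewrite ltnn.
Qed.

End Rank.

Lemma alternating_onP (F : fieldType) n (G : {set {set 'I_n}}) (A : 'M[F]_n) :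
  reflect (alternating_form A /\ forall i j, A i j != 0 -> [set i; j] \in G)
          (A \in alternating_on F G).
Proof.
apply: (iffP andP) => -[/alternatingP altA AG]; split=> //.
- move=> i j; apply: contraNT; move/forallP: AG => /(_ i)/forallP/(_ j)/implyP.
  exact.
- apply/forallP => i; apply/forallP => j; apply/implyP; apply: contraNT.
  exact: AG.
Qed.

Lemma max_rank_leP (F : fieldType) n (S : {pred 'M[F]_n}) m :
  reflect (forall A, A \in S -> (\rank A <= m)%N) (max_rank S <= m)%N.
Proof.
apply: (iffP (bigmax_leqP _ _ _)) => [h A AS|h r /asboolP[A AS <-]]; last exact: h.
have lt : (\rank A < n.+1)%N by rewrite ltnS rank_leq_row.
by apply: (h (Ordinal lt)); apply/asboolP; exists A.
Qed.

(** * Coordinates indexed by edges *)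

Section EdgeCoordinates.
Variables (F : fieldType) (n : nat) (G : {set {set 'I_n}}).

(** The sum avoids choosing endpoints; on a pair only the entry above the diagonal remains. *)
Definition edge_entry (A : 'M[F]_n) (e : {set 'I_n}) : F :=
  \sum_(i in e) \sum_(j in e | (i < j)%N) A i j.

Definition edge_coords (A : 'M[F]_n) : 'rV[F]_#|G| :=
  \row_k edge_entry A (enum_val k).

Lemma edge_coords_is_linear : linear edge_coords.
Proof.
move=> c A A'; apply/rowP => k; rewrite !mxE /edge_entry mulr_sumr -big_split.
apply: eq_bigr => i _; rewrite /= mulr_sumr -big_split.
by apply: eq_bigr => j _; rewrite /= !mxE.
Qed.
HB.instance Definition _ :=
  GRing.isLinear.Build F 'M[F]_n 'rV[F]_#|G| *:%R edge_coords
    edge_coords_is_linear.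

Lemma edge_entryE (A : 'M[F]_n) (i j : 'I_n) :
  (i < j)%N -> edge_entry A [set i; j] = A i j.
Proof.
move=> ij; have nij : i != j by apply: contraTneq ij => ->; rewrite ltnn.
rewrite /edge_entry big_setU1 ?inE //= big_set1 [X in _ + X]big1 ?addr0; last first.
  by move=> k; rewrite !inE => /andP[/orP[]/eqP->]; rewrite ?ltnn // ltnNge ltnW.
rewrite (big_pred1 j) // => k; rewrite !inE.
have [->|_] := eqVneq k j; first by rewrite ij orbT.
by have [->|//] := eqVneq k i; rewrite ltnn.
Qed.

Definition edge_matrix (x : 'rV[F]_#|G|) : 'M[F]_n :=
  \matrix_(i, j) \sum_k x 0 k *
     (((enum_val k == [set i; j]) && (i < j)%N)%:R
      - ((enum_val k == [set i; j]) && (j < i)%N)%:R).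

Lemma edge_matrix_is_linear : linear edge_matrix.
Proof.
move=> c x y; apply/matrixP => i j; rewrite !mxE mulr_sumr -big_split.
by apply: eq_bigr => k _; rewrite /= !mxE; ring.
Qed.
HB.instance Definition _ :=
  GRing.isLinear.Build F 'rV[F]_#|G| 'M[F]_n *:%R edge_matrix
    edge_matrix_is_linear.

Lemma edge_matrix_alternating_on x : edge_matrix x \in alternating_on F G.
Proof.
apply/alternating_onP; split; first split.
- by move=> i; rewrite mxE big1 // => k _; rewrite ltnn andbF subrr mulr0.
- move=> i j; rewrite !mxE -sumrN; apply: eq_bigr => k _.
  by rewrite (setUC [set j]); ring.
move=> i j; rewrite mxE; apply: contraNT => ijG; rewrite big1 // => k _.
have /negbTE-> : enum_val k != [set i; j].
  by apply: contraNneq ijG => <-; apply: enum_valP.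
by rewrite subrr mulr0.
Qed.

Lemma card2_ltP (e : {set 'I_n}) : #|e| = 2 ->
  exists i j : 'I_n, (i < j)%N /\ e = [set i; j].
Proof.
move=> /eqP/cards2P[i [j [ij ->]]]; move: ij; rewrite neq_ltn => /orP[] ij.
  by exists i, j.
by exists j, i; rewrite setUC.
Qed.

Lemma edge_matrix_inj : G \subset pairs n -> injective edge_matrix.
Proof.
move=> Gp; apply: raddf_inj => x x0; apply/rowP => k; rewrite mxE.
have : enum_val k \in pairs n by apply: (subsetP Gp); apply: enum_valP.
rewrite inE => /eqP/card2_ltP[i [j [ij kE]]].
move/matrixP: x0 => /(_ i j); rewrite !mxE (bigD1 k) //= kE eqxx ij.
rewrite ltnNge (ltnW ij) subr0 mulr1 big1 ?addr0 // => l lk.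
rewrite -kE (inj_eq enum_val_inj) (negbTE lk) subr0 mulr0 //.
Qed.

End EdgeCoordinates.

(** * From graphs to spaces and back *)

Lemma exists_alternating_space (F : fieldType) n (G : {set {set 'I_n}}) :
  G \subset pairs n -> exists U : {vspace 'M[F]_n},
  {subset U <= alternating_on F G} /\ \dim U = #|G|.
Proof.
move=> Gp; exists (limg (linfun (@edge_matrix F n G))); split.
  by move=> A /memv_imgP[x _ ->]; rewrite lfunE; apply: edge_matrix_alternating_on.
rewrite limg_dim_eq ?dimvf ?dim_matrix ?mul1r //.
apply/eqP; rewrite capfv; apply/lker0P => x y; rewrite !lfunE.
exact: edge_matrix_inj.
Qed.

(** The coordinates at the leading edges are injective on [U]: a nonzero element has a nonzero entry
    at its own heaviest edge, which belongs to [G']. *)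
Lemma leading_edges (F : fieldType) n (G : {set {set 'I_n}})
    (U : {vspace 'M[F]_n}) :
  {subset U <= alternating_on F G} ->
  exists (G' : {set {set 'I_n}}) (B : {set 'I_n} -> 'M[F]_n),
  [/\ G' \subset G, (\dim U <= #|G'|)%N
    & {in G', forall e, leading e (B e) /\ B e \in U}].
Proof.
move=> UG.
pose lead e := exists A, leading e A /\ A \in U.
pose G' := [set e in G | `[< lead e >]].
have [B BP] : exists B, forall e, lead e -> leading e (B e) /\ B e \in U.
  have : forall e, exists A, lead e -> leading e A /\ A \in U.
    move=> e; have [[A AP]|nl] := pselect (lead e); first by exists A.
    by exists 0.
  by case/choice=> B BP; exists B.
exists G', B; split; last first.
- by move=> e; rewrite inE => /andP[_ /asboolP/BP].
- rewrite -(@limg_dim_eq _ _ _ (linfun (@edge_coords F n G'))).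
    by rewrite (leq_trans (dimvS (subvf _))) // dimvf dim_matrix mul1r.
  apply/eqP; rewrite -subv0; apply/subvP => A /memv_capP[AU].
  rewrite memv_ker lfunE memv0 /=; apply: contraTT => An0.
  have [[A0 AN] AG] := elimT (alternating_onP _ _) (UG _ AU).
  have [[i j] /= Aij maxij] : exists2 p : 'I_n * 'I_n, A p.1 p.2 != 0 &
      forall q : 'I_n * 'I_n, A q.1 q.2 != 0 -> (2 ^ q.1 + 2 ^ q.2 <= 2 ^ p.1 + 2 ^ p.2)%N.
    have [p0 p0P] : exists p : 'I_n * 'I_n, A p.1 p.2 != 0.
      apply/existsP; apply: contraNT An0; rewrite negb_exists => /forallP h.
      by apply/eqP/matrixP => i j; rewrite mxE; apply/eqP/negPn; apply: (h (i, j)).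
    case: (@arg_maxnP _ p0 (fun p => A p.1 p.2 != 0) (fun p => 2 ^ p.1 + 2 ^ p.2)%N p0P).
    by move=> p Ap maxp; exists p.
  (* The weight is symmetric and [A] antisymmetric, so the heaviest entry may be taken above the
     diagonal, where [edge_entry] reads it. *)
  wlog ij : i j Aij maxij / (i < j)%N.
    move=> wl; have : i != j by apply: contraNneq Aij => ->; rewrite A0.
    rewrite neq_ltn => /orP[|ji]; first exact: wl.
    apply: (wl j i) => //; first by rewrite AN oppr_eq0.
    by move=> q; rewrite [X in (_ <= X)%N]addnC; apply: maxij.
  have nij : i != j by apply: contraTneq ij => ->; rewrite ltnn.
  have eG' : [set i; j] \in G'.
    rewrite inE AG //=; apply/asboolP; exists A; split=> //; split.
      move=> a b Aab; have := maxij (a, b) Aab.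
      by rewrite /edge_weight big_setU1 ?inE //= big_set1.
    move=> a b /esym/setP abE.
    have := abE a; have := abE b; rewrite !inE !eqxx ?orbT /= => /esym bE /esym aE.
    case/orP: aE => /eqP aE; case/orP: bE => /eqP bE; subst a b => //.
    + by have := abE j; rewrite !inE eqxx orbT orbb eq_sym (negbTE nij).
    + by rewrite AN oppr_eq0.
    + by have := abE i; rewrite !inE eqxx orbb (negbTE nij).
  apply: contra Aij => /eqP/rowP/(_ (enum_rank_in eG' [set i; j])).
  by rewrite !mxE enum_rankK_in // edge_entryE // => ->.
- by apply/subsetP => e; rewrite inE => /andP[].
Qed.

Theorem theorem1p8 (F : fieldType) (n k : nat) (n_ge1 : (1 <= n)%N)
    (G : {set {set 'I_n}}) (G_graph : G \subset pairs n) :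
  is_max
    (fun d : nat => exists U : {vspace 'M[F]_n},
       [/\ {subset U <= alternating_on F G},
           (max_rank (mem U) <= 2 * k)%N
         & \dim U = d])
    (\max_(G' : {set {set 'I_n}} |
        (G' \subset G) && (matching_number G' <= k)%N) #|G'|)%N.
Proof.
split.
  (* The empty graph is admissible, so the maximum is attained by some [G']. *)
  have P0 : (set0 \subset G) && (matching_number (set0 : {set {set 'I_n}}) <= k)%N.
    rewrite sub0set; apply/bigmax_leqP => M /andP[].
    by rewrite subset0 => /eqP-> _; rewrite cards0.
  rewrite (bigmax_eq_arg set0) //; case: arg_maxnP => // G' /andP[sG' nuG'] _.
  have [U [UG' dU]] := exists_alternating_space F (subset_trans sG' G_graph).
  exists U; split=> // [A /UG'/alternating_onP[altA AG']|].
    apply/alternating_onP; split=> // i j /AG'; exact: (subsetP sG').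
  apply/max_rank_leP => A /UG'/alternating_onP[altA AG'].
  by rewrite (leq_trans (rank_le_matching_number altA AG')) // leq_pmul2l.
move=> d [U [UG /max_rank_leP rkU <-]].
have [G' [B [sG' dU ldB]]] := leading_edges UG.
apply: leq_trans dU _; apply: (leq_bigmax_cond G'); rewrite sG' /=.
apply/bigmax_leqP => M /andP[sM tM].
have [A AU [s pf0]] : exists2 A, A \in U & exists s, pfaffian A #|M| s != 0.
  apply: (leading_matching tM); last by move=> e /(subsetP sM); apply: ldB.
  exact: subset_trans sM (subset_trans sG' G_graph).
have [altA _] := elimT (alternating_onP _ _) (UG _ AU).
have := leq_trans (pfaffian_rank_ge altA pf0) (rkU _ AU).
by rewrite mul2n leq_double.
Qed.
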